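(* Let $a,b$ be relatively prime positive integers such that $a$ is even and $b>2a$ (so $b$ is odd). Then the sequence $\mathcal{V}(a,b)$ has at least $2+\lfloor a/4\rfloor$ even terms.
   Context: For positive integers $a<b$, the sequence $\mathcal{V}(a,b)=(a_m)_{m\geqslant 1}$ is defined greedily by $a_1=a$, $a_2=b$, and, for $m\geqslant 2$, $a_{m+1}$ is the smallest integer larger than $a_m$ that can be written as $a_i+a_j$ with $i\leqslant j\leqslant m$ (the two earlier terms not necessarily distinct) in exactly one way (representations are unordered pairs). *)

(* Defs.v *)
From mathcomp Require Import all_boot.
Set Implicit Arguments.
Unset Strict Implicit.
Unset Printing Implicit Defensive.

(* Sequences are indexed from 0: [u i] stands for a_{i+1}, so that
   [u 0, ..., u m.-1] are the first [m] terms. *)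

(* Index pairs i <= j represent unordered pairs of terms, since the terms of
   the sequences considered below are pairwise distinct. *)
Definition nreps (u : nat -> nat) (m k : nat) : nat :=
  #|[set p : 'I_m * 'I_m | (p.1 <= p.2) && (u p.1 + u p.2 == k)]|.

(* [isV a b u] : u is the sequence V(a, b). The term [u m.+2] is chosen from
   the first m + 2 terms, the largest of which is [u m.+1]. *)
Definition isV (a b : nat) (u : nat -> nat) : Prop :=
  [/\ u 0 = a, u 1 = b &
      forall m, [/\ u m.+1 < u m.+2,
                    nreps u m.+2 (u m.+2) = 1 &
                    forall k, u m.+1 < k < u m.+2 -> nreps u m.+2 k <> 1]].

Lemma eq_nreps u v m k :
  (forall i, i < m -> u i = v i) -> nreps u m k = nreps v m k.
Proof.
move=> uv; apply: eq_card => -[i j]; rewrite !inE /=.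
by rewrite (uv _ (ltn_ord i)) (uv _ (ltn_ord j)).
Qed.

Lemma nreps_double u m :
  (forall i, i < m -> u i < u m) -> nreps u m.+1 (u m + u m) = 1.
Proof.
move=> um; have le i : i < m.+1 -> u i <= u m ?= iff (i == m).
  rewrite ltnS leq_eqVlt => /predU1P [->|lt_im]; first exact/leqif_refl.
  by apply/leqifP; rewrite (ltn_eqF lt_im) um.
rewrite /nreps; apply/eqP/cards1P; exists (ord_max, ord_max).
apply/setP=> -[i j]; rewrite !inE /= xpair_eqE -!val_eqE /=.
rewrite (leqif_add (le _ (ltn_ord i)) (le _ (ltn_ord j))).2.
by case: eqP => [->|]; case: eqP => [->|] //=; rewrite ?leqnn ?andbF.
Qed.

Definition next_term (u : nat -> nat) (m : nat) : nat :=
  find (fun k => (u m.+1 < k) && (nreps u m.+2 k == 1))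
       (iota 0 (u m.+1 + u m.+1).+1).

Lemma next_termP u m :
  0 < u m.+1 -> (forall i, i < m.+1 -> u i < u m.+1) ->
  [/\ u m.+1 < next_term u m, nreps u m.+2 (next_term u m) = 1 &
      forall k, u m.+1 < k < next_term u m -> nreps u m.+2 k <> 1].
Proof.
move=> u0 um; rewrite /next_term; set P := (fun k => _); set s := iota _ _.
have hasP : has P s.
  apply/hasP; exists (u m.+1 + u m.+1); first by rewrite mem_iota add0n ltnSn.
  by rewrite /P nreps_double // -[ltnLHS]addn0 ltn_add2l u0.
have := hasP; rewrite has_find size_iota => lt_f.
have := nth_find 0 hasP; rewrite nth_iota // add0n => /andP [lt1 /eqP eq1].
split=> // k /andP [lt_k k_lt] k1; have := before_find 0 k_lt.
by rewrite nth_iota ?(ltn_trans k_lt) // add0n /P lt_k k1.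
Qed.

Fixpoint approx (a b n : nat) : nat -> nat :=
  if n is m.+1 then
    fun i => if i < m.+2 then approx a b m i else next_term (approx a b m) m
  else fun i => if i is 0 then a else b.

(* The greedy rule always produces a next term, twice the largest term being a
   candidate, so that V(a, b) exists; it is unique by [isV_unique]. *)
Lemma isV_exists a b : 0 < a < b -> exists u, isV a b u.
Proof.
case/andP => a0 ab; pose u n := approx a b n n.
have ua m n i : m <= n -> i < m.+2 -> approx a b n i = approx a b m i.
  move=> /subnKC <- i_m; elim: (n - m) => [|d IH]; first by rewrite addn0.
  rewrite addnS /= ifT ?IH //.
  by apply: leq_trans i_m _; rewrite !ltnS leq_addr.
have au m i : i < m.+2 -> approx a b m i = u i.
  rewrite ltnS leq_eqVlt => /predU1P [->|]; first by rewrite /u (ua m m.+1).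
  by rewrite ltnS => le_im; rewrite /u (ua i m).
have uS m : u m.+2 = next_term (approx a b m) m.
  by rewrite -(au m.+1) //= ltnn.
have incr m : (0 < u m.+1) /\ (forall i, i < m.+1 -> u i < u m.+1).
  elim: m => [|m [IH0 IH]].
    have u1 : u 1 = b by rewrite -(au 0).
    rewrite u1; split; first exact: ltn_trans ab.
    by case.
  have [|i lt_i|+ _ _] := @next_termP (approx a b m) m; rewrite ?au //.
    - exact: IH.
    - exact: ltn_trans lt_i _.
  rewrite -uS => lt_u; split; first exact: leq_ltn_trans lt_u.
  move=> i; rewrite ltnS leq_eqVlt => /predU1P [->//|/IH].
  by move=> /ltn_trans; apply.
exists u; split=> [//||m]; first by rewrite -(au 0).
have [u0 um] := incr m.
have E k : nreps u m.+2 k = nreps (approx a b m) m.+2 k.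
  by apply: eq_nreps => i /au.
have [|i lt_i|lt1 r1 min1] := @next_termP (approx a b m) m; rewrite ?au //.
  - exact: um.
  - exact: ltn_trans lt_i _.
rewrite uS; split; first by rewrite -(au m).
  by rewrite E.
by move=> k; rewrite E -{1}(au m) //; apply: min1.
Qed.

Lemma isV_unique a b u v : isV a b u -> isV a b v -> u =1 v.
Proof.
move=> [u0 u1 uS] [v0 v1 vS] n.
suff: forall i, i <= n -> u i = v i by apply.
elim: n => [|[|n] IH] i; first by rewrite leqn0 => /eqP ->; rewrite u0 v0.
  by case: i => [|[|]] // _; rewrite ?u0 ?v0 ?u1 ?v1.
rewrite leq_eqVlt ltnS => /predU1P [->|]; last exact: IH.
have E k : nreps u n.+2 k = nreps v n.+2 k by apply: eq_nreps => j /IH.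
have [ltu ru mu] := uS n; have [ltv rv mv] := vS n.
have e1 := IH _ (leqnn _).
case: (ltngtP (u n.+2) (v n.+2)) => // lt.
- by case: (mv (u n.+2)); rewrite -?E // -e1 ltu lt.
- by case: (mu (v n.+2)); rewrite ?E // e1 ltv lt.
Qed.

(* Main.v *)
Require Import Defs.
From mathcomp Require Import all_boot.
From mathcomp Require Import zify.

(* Every term is x * b + y * a with x, y >= 0, and up to a * b + a these
   coordinates are essentially unique because a and b are coprime.  In this
   range the only even terms are a, 2b and 4kb + a for k >= 1; that is
   2 + floor(a/4) of them.  Writing (x, y) for x * b + y * a, an odd number is
   a term iff exactly one of (x, y - 1), (x - 2, y), (x - 4k, y - 1) is, which
   shows that (x, 0) and (1, y) are terms, that (x, 1) is not for x >= 3, that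
   (3, y) is one iff y is even and (5, y) iff y = 0 or y >= 3 is odd.  These odd
   terms provide two representations of every even number of the range, except
   for (2, 0), which is (1, 0) + (1, 0) only, and (4k, 1), which is
   (1, 1) + (4k - 1, 0) only. *)

(** Coprimality makes [a] divide the difference of the first coordinates, so distinct ones are at
    least [a] apart. *)
Lemma coprime_coords (a b x y x' y' : nat) :
    coprime a b -> 0 < a -> x * b + y * a = x' * b + y' * a ->
  [\/ x = x' /\ y = y', x' + a <= x | x + a <= x'].
Proof.
move=> cop a0; wlog le_x : x y x' y' / x <= x' => [W|eq_n].
  have [/W|/ltnW/W H eq_n] := leqP x x'; first exact.
  by case: (H y' y) => [//|[-> ->]|?|?]; [apply: Or31|apply: Or33|apply: Or32].
have eq_d : (x' - x) * b = (y - y') * a by rewrite !mulnBl; lia.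
have : a %| x' - x by rewrite -(Gauss_dvdl _ cop) eq_d dvdn_mull.
case/dvdnP=> -[|q] Eq; last by apply: Or33; nia.
by apply: Or31; split; [lia|nia].
Qed.

(** * Consequences of the greedy rule for an abstract set [T] of terms *)

Section EvenTerms.

Variables (a b : nat) (T : nat -> Prop).
Hypotheses (a_gt0 : 0 < a) (coprime_ab : coprime a b) (even_a : ~~ odd a).
Hypothesis lt_2a_b : 2 * a < b.
Hypotheses (T_a : T a) (T_b : T b).
Hypothesis T_le_b : forall n, T n -> n <= b -> n = a \/ n = b.
Hypothesis T_greedy : forall n, b < n ->
  (T n <-> exists x y, [/\ T x, T y, x + y = n &
     forall x' y', T x' -> T y' -> x' + y' = n -> x' = x \/ x' = y]).

Lemma odd_b : odd b.
Proof.
apply/negP => /negP even_b.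
have : 2 %| gcdn a b by rewrite dvdn_gcd !dvdn2 even_a.
by rewrite (eqP coprime_ab).
Qed.

Lemma odd_coords x y : odd (x * b + y * a) = odd x.
Proof. by rewrite oddD !oddM odd_b (negbTE even_a) andbT andbF addbF. Qed.

Lemma mulb_neq_addba x z : x * b <> z * b + a.
Proof. by move=> E; case: (leqP x z) => /leq_mul/(_ (leqnn b)); lia. Qed.

(** Serves to check that two sums with the same value are not swaps of each other. *)
Lemma mula_neq_mulb y z : 0 < y -> z < a -> y * a <> z * b.
Proof.
move=> y0 z_a E; have {}E : 0 * b + y * a = z * b + 0 * a by lia.
by case: (coprime_coords _ _ _ _ _ _ coprime_ab a_gt0 E); lia.
Qed.

Lemma mulb_inj x z : x * b = z * b -> x = z.
Proof. by move/eqP; rewrite eqn_pmul2r ?(odd_gt0 odd_b) // => /eqP. Qed.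

Lemma term_gt0 n : T n -> 0 < n.
Proof. by case: n => // /T_le_b[]//; lia. Qed.

Lemma term_unique_sum x y : b < x + y -> T x -> T y ->
    (forall x' y', T x' -> T y' -> x' + y' = x + y -> x' = x \/ x' = y) ->
  T (x + y).
Proof. by move=> lt_b Tx Ty uniq_xy; apply/T_greedy => //; exists x, y. Qed.

Lemma not_term_two_sums x y x' y' : T x -> T y -> T x' -> T y' ->
  b < x + y -> x' + y' = x + y -> x' <> x -> x' <> y -> ~ T (x + y).
Proof.
move=> Tx Ty Tx' Ty' lt_b eq_s ne1 ne2 /(T_greedy _ lt_b).
case=> u [v [_ _ uv uniq_uv]].
have := uniq_uv _ _ Tx Ty erefl; have := uniq_uv _ _ Tx' Ty' eq_s; lia.
Qed.

Lemma term_coords n : T n -> exists x y, n = x * b + y * a.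
Proof.
elim/ltn_ind: n => n IH Tn; have [/(T_le_b _ Tn)[]->|lt_b] := leqP n b.
- by exists 0, 1; lia.
- by exists 1, 0; lia.
have [u [v [Tu Tv uv _]]] := (T_greedy _ lt_b).1 Tn.
have u0 := term_gt0 _ Tu; have v0 := term_gt0 _ Tv.
have [x [y uE]] := IH u ltac:(lia) Tu; have [x' [y' vE]] := IH v ltac:(lia) Tv.
by exists (x + x'), (y + y'); lia.
Qed.

Definition even_shape n :=
  [\/ n = a, n = 2 * b | exists2 k, 0 < k & n = 4 * k * b + a].

(** The statement of the strong induction; the fields on odd numbers feed those on even ones. The
    bounds against [a] keep first coordinates below [a], since [(x, y)] and [(x - a, y + b)] are the
    same number. *)
Record shape n : Prop := Shape {
  shape_even : T n -> ~~ odd n -> even_shape n;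
  shape_term : even_shape n -> T n;
  shape_x0 : forall x, odd x -> n = x * b -> T n;
  shape_1y : forall y, n = b + y * a -> T n;
  shape_3y : forall y, n = 3 * b + y * a -> 3 < a -> (T n <-> ~~ odd y);
  shape_5y : forall y, n = 5 * b + y * a -> 5 < a ->
    (T n <-> y = 0 \/ odd y /\ 3 <= y);
  shape_x1 : forall x, odd x -> 3 <= x -> x < a -> n = x * b + a -> ~ T n
}.

Section Step.

Variable n : nat.
Hypothesis lt_b_n : b < n.
Hypothesis n_le : n <= a * b + a.
(* For [a = 2], [2 * b + a] is a sum of terms in two ways and the pattern of
   even terms stops at [2 * b]. *)
Hypothesis n_le2 : 4 <= a \/ n <= a * b.
Hypothesis IH : forall m, m < n -> shape m.

(** Each summand is even, hence equal to [a]: [2 * b] is a multiple of [a] only if [a = 2], where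
    [n <= 2 * b], and [4 * k * b + a] only if [a] divides [4 * k], which makes it at least
    [a * b + a]. But [2 * a < b]. This disposes of the second coordinates [(0, y + b)] of a number
    [(a, y)]. *)
Lemma no_multiples u v y y' : T u -> T v -> u + v = n ->
  u = y * a -> v = y' * a -> False.
Proof.
have half z w y0 : T z -> T w -> z + w = n -> z = y0 * a -> z = a.
  move=> Tz Tw zw zE; have w0 := term_gt0 _ Tw.
  have lt_z : z < n by lia.
  have ev_z : ~~ odd z by rewrite zE oddM (negbTE even_a) andbF.
  have dvd_x : forall x, z = x * b -> a %| x.
    by move=> x zx; rewrite -(Gauss_dvdl _ coprime_ab) -zx zE dvdn_mull.
  case: (shape_even _ (IH _ lt_z) Tz ev_z) => // [z2|[k k0 zk]].
    have /dvdn_leq := dvd_x 2 z2; have := Tw.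
    case: n_le2 => [|]; first by lia.
    by move=> ? /term_gt0 ? /(_ isT); nia.
  have : a %| 4 * k.
    rewrite -(Gauss_dvdl _ coprime_ab) -(dvdn_addl _ (dvdnn a)) -zk zE.
    exact: dvdn_mull.
  by move/dvdn_leq => /(_ ltac:(lia)); nia.
move=> Tu Tv uv uE vE; have Eu := half _ _ _ Tu Tv uv uE.
have Ev := half _ _ _ Tv Tu ltac:(lia) vE.
lia.
Qed.


Lemma odd_lt_a x y : n = x * b + y * a -> odd x -> x < a.
Proof.
move=> nE odd_x; rewrite ltn_neqAle; apply/andP; split.
  by apply: contraL odd_x => /eqP ->.
by rewrite leqNgt; apply/negP => lt_x; nia.
Qed.

(** An odd sum has exactly one even summand, which has one of the three even shapes by induction. As
    [x < a], the coordinates of [n] are unique, and subtraction determines the odd summand. *)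
Lemma odd_sum x y u v : odd x -> n = x * b + y * a -> T u -> T v -> u + v = n ->
  exists e f, [/\ T f, e + f = n, u = e \/ u = f &
    [\/ [/\ e = a, 0 < y & f = x * b + y.-1 * a],
        [/\ e = 2 * b, 2 <= x & f = (x - 2) * b + y * a] |
        exists k, [/\ 0 < k, 4 * k <= x, 0 < y, e = 4 * k * b + a &
                      f = (x - 4 * k) * b + y.-1 * a]]].
Proof.
move=> odd_x nE Tu Tv uv.
wlog ev_u : u v Tu Tv uv / ~~ odd u => [W|].
  have [odd_u|ev_u] := boolP (odd u); last exact: (W u v).
  have ev_v : ~~ odd v.
    by have := odd_coords x y; rewrite -nE -uv oddD odd_x odd_u; case: odd.
  have [e [f [Tf ef ve H]]] := W v u Tv Tu ltac:(lia) ev_v.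
  by exists e, f; split=> //; lia.
have u0 := term_gt0 _ Tu; have v0 := term_gt0 _ Tv.
have lt_x := odd_lt_a _ _ nE odd_x.
exists u, v; split=> //; first by left.
have [x1 [y1 vE]] := term_coords _ Tv.
have C s t : u = s * b + t * a -> x = s + x1 /\ y = t + y1.
  move=> uE; have E : x * b + y * a = (s + x1) * b + (t + y1) * a by lia.
  case: (coprime_coords _ _ _ _ _ _ coprime_ab a_gt0 E) => // le_x; first by lia.
  (* Oddness gives [x >= 1], so a first coordinate of at least [x + a] would push [n] to [a * b + b]
     or more. *)
  have x0 : b <= x * b by rewrite leq_pmull ?odd_gt0.
  by have := leq_mul le_x (leqnn b); rewrite mulnDl; lia.
case: (shape_even _ (IH u ltac:(lia)) Tu ev_u) => [uE|uE|[k k0 uE]].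
- have [-> ->] := C 0 1 ltac:(lia); apply: Or31; split=> //; lia.
- have [-> ->] := C 2 0 ltac:(rewrite uE; lia); apply: Or32; split=> //; lia.
- have [-> ->] := C (4 * k) 1 ltac:(lia); apply: Or33; exists k; split=> //; lia.
Qed.

(** * Induction step for odd numbers *)

Lemma step_x0 x : odd x -> n = x * b -> T n.
Proof.
move=> odd_x nE; have x3 : 3 <= x.
  by case: x odd_x nE => [|[|[|x]]] // _; lia.
have odd_x2 : odd (x - 2) by rewrite oddB ?odd_x //; lia.
have nS : n = 2 * b + (x - 2) * b by rewrite -mulnDl nE; congr (_ * _); lia.
have T2b : T (2 * b) by apply: (shape_term _ (IH (2 * b) _)); [nia|apply: Or32].
have Tx2 : T ((x - 2) * b) by apply: (shape_x0 _ (IH _ _) (x - 2)) => //; nia.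
rewrite nS; apply: term_unique_sum => //; first by lia.
rewrite -nS => u v Tu Tv uv.
have [|e [f [Tf ef ue]]] := odd_sum x 0 u v odd_x _ Tu Tv uv; first by lia.
by case=> [[]|[]|[k []]]; lia.
Qed.

Lemma step_1y y : n = b + y * a -> T n.
Proof.
case: y => [|y] nE; first by lia.
have Ty : T (b + y * a) by apply: (shape_1y _ (IH _ _) y) => //; lia.
have nS : n = a + (b + y * a) by lia.
rewrite nS; apply: term_unique_sum => //; first by lia.
rewrite -nS => u v Tu Tv uv.
have [|e [f [Tf ef ue]]] := odd_sum 1 y.+1 u v isT _ Tu Tv uv; first by lia.
by case=> [[]|[]//|[k []]]; lia.
Qed.

(** For [y > 0] the sum of [2 * b] and [(1, y)] is always available; its only rival is [a] plus
    [(3, y - 1)], so terms alternate along the row. *)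
Lemma step_3y y : n = 3 * b + y * a -> 3 < a -> (T n <-> ~~ odd y).
Proof.
move=> nE a3; case: y => [|y] in nE *.
  by split=> // _; apply: (step_x0 3) => //; lia.
have T2b : T (2 * b) by apply: (shape_term _ (IH (2 * b) _)); [lia|apply: Or32].
have T1y : T (b + y.+1 * a) by apply: (shape_1y _ (IH _ _) y.+1) => //; lia.
have H := shape_3y _ (IH _ _) y erefl a3; split=> [Tn|ev_y].
  apply/negP => odd_y.
  have T3y : T (3 * b + y * a) by apply/H; lia.
  suff: ~ T (2 * b + (b + y.+1 * a)).
    by apply; have -> : 2 * b + (b + y.+1 * a) = n by lia.
  by apply: (not_term_two_sums _ _ a (3 * b + y * a)) => //; lia.
have -> : n = 2 * b + (b + y.+1 * a) by lia.
apply: term_unique_sum => //; first by lia.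
move=> u v Tu Tv uv.
have [e [f [Tf ef ue]]] := odd_sum 3 y.+1 u v isT nE Tu Tv ltac:(lia).
case=> [[ea _ fE]|[]|[k []]]; try lia.
by move: Tf; rewrite fE => /H; lia.
Qed.

(** For [y > 0] the sum of [4 * b + a] and [(1, y - 1)] is always available; the rivals are [a] plus
    [(5, y - 1)] and [2 * b] plus [(3, y)]. The first rules out [y = 1], the second every even [y],
    and neither exists for odd [y >= 3]. *)
Lemma step_5y y : n = 5 * b + y * a -> 5 < a ->
  (T n <-> y = 0 \/ odd y /\ 3 <= y).
Proof.
move=> nE a5; case: y => [|y] in nE *.
  split=> [_|_]; first by left.
  by apply: (step_x0 5) => //; lia.
have T2b : T (2 * b) by apply: (shape_term _ (IH (2 * b) _)); [lia|apply: Or32].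
have T4b : T (4 * b + a).
  by apply: (shape_term _ (IH _ _)); [lia|apply: Or33; exists 1 => //; lia].
have T1y : T (b + y * a) by apply: (shape_1y _ (IH _ _) y) => //; lia.
have nE2 : n = (4 * b + a) + (b + y * a) by lia.
have H3 := shape_3y _ (IH (3 * b + y.+1 * a) ltac:(lia)) y.+1 erefl ltac:(lia).
have H5 := shape_5y _ (IH (5 * b + y * a) ltac:(lia)) y erefl a5; split=> [Tn|].
  right; suff: ~ (y = 0 \/ ~~ odd y.+1) by lia.
  move=> bad; suff: ~ T (4 * b + a + (b + y * a)) by rewrite -nE2.
  case: bad => [y1|ev_y].
    have T5 : T (5 * b + y * a) by apply/H5; left; lia.
    by apply: (not_term_two_sums _ _ a (5 * b + y * a)) => //; lia.
  have T3y : T (3 * b + y.+1 * a) by apply/H3.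
  have ne : 2 * b <> b + y * a.
    by move=> E; have := odd_coords 1 y; rewrite mul1n -E oddM.
  by apply: (not_term_two_sums _ _ (2 * b) (3 * b + y.+1 * a)) => //; lia.
case=> [|[odd_y y3]]; first by lia.
rewrite nE2; apply: term_unique_sum => //; first by lia.
rewrite -nE2 => u v Tu Tv uv.
have [e [f [Tf ef ue]]] := odd_sum 5 y.+1 u v isT nE Tu Tv ltac:(lia).
case=> [[ea _ fE]|[eE _ fE]|[k [k0 k5 _ eE _]]].
- by move: Tf; rewrite fE => /H5; lia.
- by move: Tf; rewrite fE => /H3; lia.
- have k1 : k = 1 by lia. by subst k; lia.
Qed.

(** For [x >= 5] the sum [a + x * b] competes with [(4 * b + a) + (x - 4) * b]; [x = 3] is the row
    [(3, y)] at [y = 1]. *)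
Lemma step_x1 x : odd x -> 3 <= x -> x < a -> n = x * b + a -> ~ T n.
Proof.
move=> odd_x x3 xa nE; have [x5|x5] := leqP 5 x; last first.
  have x_3 : x = 3 by lia.
  by case: (step_3y 1 ltac:(rewrite nE x_3; lia) ltac:(lia)) => H _ /H.
have Tx : T (x * b) by apply: (shape_x0 _ (IH _ _) x) => //; lia.
have odd_x4 : odd (x - 4) by lia.
have Tx4 : T ((x - 4) * b) by apply: (shape_x0 _ (IH _ _) (x - 4)) => //; nia.
have T4b : T (4 * b + a).
  by apply: (shape_term _ (IH _ _)); [nia|apply: Or33; exists 1 => //; lia].
rewrite nE addnC; have xE : x * b = 4 * b + (x - 4) * b by nia.
by apply: (not_term_two_sums _ _ (4 * b + a) ((x - 4) * b)) => //; nia.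
Qed.

(** * Induction step for even numbers *)

Lemma step_2b : n = 2 * b -> T n.
Proof.
move=> nE; have -> : n = b + b by lia.
apply: term_unique_sum => //; first by lia.
move=> u v Tu Tv uv; have u0 := term_gt0 _ Tu; have v0 := term_gt0 _ Tv.
have [x [y uE]] := term_coords _ Tu; have [x' [y' vE]] := term_coords _ Tv.
have E : 2 * b + 0 * a = (x + x') * b + (y + y') * a by lia.
case: (coprime_coords _ _ _ _ _ _ coprime_ab a_gt0 E) => [[]|le_2|le_x].
- by case: x uE {E} => [|[|x]] uE *; nia.
(* Here [a = 2], and both summands are multiples of [a]. *)
- have x0 : x = 0 by lia. have x'0 : x' = 0 by lia.
  by case: (no_multiples u v y y') => //; lia.
- by have := leq_mul le_x (leqnn b); lia.
Qed.

(** The second coordinates of two summands are 1 and 0. If the first coordinates are odd, the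
    absence of [(x, 1)] for [x >= 3] leaves [(1, 1)] and [(4 * k - 1, 0)]. If they are even, the
    summands are even terms, so [2 * b] and [(4 * k - 2, 1)], but 4 does not divide [4 * k - 2]. *)
Lemma step_4kb_a k : 0 < k -> n = 4 * k * b + a -> T n.
Proof.
move=> k0 nE.
have odd_k : odd (4 * k - 1) by lia.
have k_a : 4 * k <= a.
  rewrite leqNgt; apply/negP => /leq_mul/(_ (leqnn b)); lia.
have ev_a : 4 <= a by lia.
have Tk : T ((4 * k - 1) * b).
  by apply: (shape_x0 _ (IH _ _) (4 * k - 1)) => //; rewrite nE mulnBl; lia.
have Tba : T (b + a) by apply: (shape_1y _ (IH _ _) 1) => //; nia.
have nS : n = (b + a) + (4 * k - 1) * b by nia.
have half u v x x' : T u -> T v -> u + v = n -> u = x * b + 1 * a -> v = x' * b ->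
    x + x' = 4 * k -> u = b + a.
  move=> Tu Tv uv uE vE xx'; have v0 := term_gt0 _ Tv; have u0 := term_gt0 _ Tu.
  have [odd_x|ev_x] := boolP (odd x).
    have [x3|x3] := leqP 3 x; last by have x1 : x = 1 by [lia]; rewrite uE x1; lia.
    have x_a : x < a by nia.
    by case: (shape_x1 _ (IH u ltac:(lia)) x odd_x x3 x_a _ Tu); lia.
  have ev_v : ~~ odd v by rewrite vE oddM; have -> : odd x' = false by lia.
  have ev_u : ~~ odd u by rewrite uE odd_coords.
  have x'2 : x' = 2.
    case: (shape_even _ (IH v ltac:(lia)) Tv ev_v) =>
      [|/(etrans (esym vE))/mulb_inj//|[k' _]].
      by rewrite vE => /(mulb_neq_addba _ 0).
    by rewrite vE => /mulb_neq_addba.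
  case: (shape_even _ (IH u ltac:(lia)) Tu ev_u) => [||[k' _]]; rewrite uE.
  - by move=> E; have /mulb_inj : x * b = 0 * b by [lia]; lia.
  - by rewrite mul1n => /esym/mulb_neq_addba.
  - by rewrite mul1n => /addIn/mulb_inj; lia.
rewrite nS; apply: term_unique_sum => //; first by lia.
rewrite -nS => u v Tu Tv uv; have u0 := term_gt0 _ Tu; have v0 := term_gt0 _ Tv.
have [x [y uE]] := term_coords _ Tu; have [x' [y' vE]] := term_coords _ Tv.
have E : 4 * k * b + 1 * a = (x + x') * b + (y + y') * a by lia.
case: (coprime_coords _ _ _ _ _ _ coprime_ab a_gt0 E) => [[xx' yy']|le_k|le_x].
- have [[y1 y'0]|[y0 y'1]] : y = 1 /\ y' = 0 \/ y = 0 /\ y' = 1 by lia.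
    by left; apply: (half u v x x') => //; lia.
  right; suff: v = b + a by lia.
  by apply: (half v u x' x) => //; lia.
- have x0 : x = 0 by lia. have x'0 : x' = 0 by lia.
  by case: (no_multiples u v y y') => //; lia.
- by have := leq_mul le_x (leqnn b); lia.
Qed.

(** Outside the three shapes, two explicit sums of terms refute [T n]; the cases on [x] and [y]
    decide which rows supply them. *)
Lemma step_even : T n -> ~~ odd n -> even_shape n.
Proof.
move=> Tn ev_n.
have [u [v [Tu Tv uv _]]] := (T_greedy _ lt_b_n).1 Tn.
have [xu [yu uE]] := term_coords _ Tu; have [xv [yv vE]] := term_coords _ Tv.
have [x xE] : exists x, x = xu + xv by exists (xu + xv).
have [y yE] : exists y, y = yu + yv by exists (yu + yv).
have nE : n = x * b + y * a by lia.
have ev_x : ~~ odd x by rewrite -(odd_coords x y) -nE.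
have le_x : x <= a.
  by rewrite leqNgt; apply/negP => /leq_mul/(_ (leqnn b)); lia.
have two p q p' q' : T p -> T q -> T p' -> T q' -> p + q = n -> p' + q' = n ->
    p' <> p -> p' <> q -> even_shape n.
  move=> Tp Tq Tp' Tq' pq pq' np nq.
  case: (not_term_two_sums p q p' q') => //; try lia.
  by rewrite pq.
have T1 z : b + z * a < n -> T (b + z * a).
  by move=> lt; apply: (shape_1y _ (IH _ lt) z).
have T0 z : odd z -> z * b < n -> T (z * b).
  by move=> odd_z lt; apply: (shape_x0 _ (IH _ lt) z).
have T3 z : 3 < a -> ~~ odd z -> 3 * b + z * a < n -> T (3 * b + z * a).
  by move=> a3 ev_z lt; apply/(shape_3y _ (IH _ lt) z).
have Te m : m < n -> even_shape m -> T m by move=> /IH/shape_term.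
have [x0|x_gt0] := posnP x.
  by case: (no_multiples u v yu yv) => //; lia.
have [x2|x_ne2] := eqVneq x 2.
  case: y nE {yE} => [|[|y]] nE; first by apply: Or32; lia.
    apply: (two b (b + 1 * a) (2 * b) a) => //; try lia.
      by apply: T1; lia.
    by apply: Te; [lia|apply: Or32].
  apply: (two b (b + y.+2 * a) (b + 1 * a) (b + y.+1 * a)) => //; try lia.
  - by apply: T1; lia.
  - by apply: T1; lia.
  - by apply: T1; lia.
have [x4|x_ne4] := eqVneq x 4.
  case: y nE {yE} => [|[|y]] nE.
  - apply: (two b (3 * b) (2 * b) (2 * b)) => //; try lia.
    + by apply: T0; lia.
    + by apply: Te; [lia|apply: Or32].
    + by apply: Te; [lia|apply: Or32].
  - by apply: Or33; exists 1; lia.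
  apply: (two (b + y.+2 * a) (3 * b) (b + y * a) (3 * b + 2 * a)) => //; try lia.
  - by apply: T1; lia.
  - by apply: T0; lia.
  - by apply: T1; lia.
  - by apply: T3; lia.
  (* The two sums are swaps of each other only if [y * a = 2 * b]. *)
  - by case: y {nE} => [|y]; [lia|have := mula_neq_mulb y.+1 2; lia].
have T5 z : 5 < a -> odd z -> 3 <= z -> 5 * b + z * a < n -> T (5 * b + z * a).
  by move=> a5 odd_z z3 lt; apply/(shape_5y _ (IH _ lt) z) => //; right.
have x6 : 6 <= x by lia.
have lt_b_x : 6 * b <= x * b by rewrite leq_mul2r x6 orbT.
have [y0|y_gt0] := posnP y.
  apply: (two b ((x - 1) * b) (3 * b) ((x - 3) * b)) => //; rewrite ?mulnBl; try lia.
  - by rewrite -[_ - _]mulnBl; apply: T0; rewrite ?mulnBl; lia.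
  - by apply: T0; lia.
  - by rewrite -mulnBl; apply: T0; rewrite ?mulnBl; lia.
(* Next to [(1, y) + (x - 1, 0)], the second sum uses [(3, y)] for even [y] and [(5, y)] for odd
   [y >= 3]. *)
have [ev_y|odd_y] := boolP (~~ odd y).
  apply: (two (b + y * a) ((x - 1) * b) (3 * b + y * a) ((x - 3) * b)) => //.
  - by apply: T1; lia.
  - by apply: T0; rewrite ?mulnBl; lia.
  - by apply: T3; lia.
  - by apply: T0; rewrite ?mulnBl; lia.
  - by rewrite mulnBl; lia.
  - by rewrite mulnBl; lia.
  - by lia.
  - by have := @mula_neq_mulb y (x - 4) y_gt0 ltac:(lia); rewrite !mulnBl; lia.
have [y3|y_lt3] := leqP 3 y.
  apply: (two (b + y * a) ((x - 1) * b) (5 * b + y * a) ((x - 5) * b)) => //.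
  - by apply: T1; lia.
  - by apply: T0; rewrite ?mulnBl; lia.
  - by apply: T5; lia.
  - by apply: T0; rewrite ?mulnBl; lia.
  - by rewrite mulnBl; lia.
  - by rewrite mulnBl; lia.
  - by lia.
  - by have := @mula_neq_mulb y (x - 6) y_gt0 ltac:(lia); rewrite !mulnBl; lia.
have y1 : y = 1 by lia.
(* For [y = 1] neither row helps; if [x = 4 * k + 2], two even terms form the second sum. *)
have [k [xk|xk]] : exists k, x = 4 * k \/ x = 4 * k + 2 by exists (x %/ 4); lia.
  by apply: Or33; exists k; [lia|rewrite nE y1 xk mul1n].
apply: (two (b + 1 * a) ((x - 1) * b) (2 * b) (4 * k * b + a)) => //.
- by apply: T1; lia.
- by apply: T0; rewrite ?mulnBl; lia.
- by apply: Te; [lia|apply: Or32].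
- by apply: Te; [lia|apply: Or33; exists k; lia].
- by rewrite mulnBl; lia.
- by lia.
- by lia.
- by rewrite mulnBl; lia.
Qed.

End Step.

(** Up to [b] the pattern is read off from [T_le_b]; beyond, the steps apply. Fixing [N] lets the
    alternative on [a] pass to all smaller numbers. *)
Lemma shape_upto N n :
  N <= a * b + a -> 4 <= a \/ N <= a * b -> n <= N -> shape n.
Proof.
move=> N_le N_le2; elim/ltn_ind: n => n IH n_le.
have [n_b|lt_b] := leqP n b; last first.
  have IH' m : m < n -> shape m by move=> lt; apply: IH => //; lia.
  have n_le1 : n <= a * b + a by lia.
  have n_le2 : 4 <= a \/ n <= a * b by lia.
  split; [exact: step_even|move=> sh_n|exact: step_x0|exact: step_1y|
          exact: step_3y|exact: step_5y|exact: step_x1].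
  case: sh_n => [|nE|[k k0 nE]]; first by lia.
    exact: step_2b.
  by apply: step_4kb_a nE.
split=> [Tn ev_n|[->|nE|[k k0 nE]]|x odd_x nE|[|y] nE|y nE|y nE|x odd_x x3 _ nE]
  //; try lia.
- move: ev_n; have [->|->] := T_le_b _ Tn n_b; first by move=> _; apply: Or31.
  by rewrite odd_b.
- by have := leq_mul k0 (leqnn b); lia.
- suff x1 : x = 1 by rewrite nE x1 mul1n.
  by case: x odd_x nE => [|[|x]] //; lia.
- by rewrite nE addn0.
Qed.

End EvenTerms.

(** * From the sequence [V] to its set of terms *)

Definition is_term (V : nat -> nat) (n : nat) : Prop := exists i, V i = n.

Section Terms.

Variables (a b : nat) (V : nat -> nat).
Hypotheses (a_gt0 : 0 < a) (lt_ab : a < b) (V_ab : isV a b V).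

Lemma isV_ltn i j : i < j -> V i < V j.
Proof.
have [V0 V1 VS] := V_ab.
have step k : V k < V k.+1 by case: k => [|k]; [rewrite V0 V1|case: (VS k)].
elim: j => // j IH; rewrite ltnS leq_eqVlt => /predU1P[->//|/IH lt_ij].
exact: ltn_trans (step j).
Qed.

Lemma isV_inj : injective V.
Proof.
by move=> i j E; case: (ltngtP i j) => // /isV_ltn; rewrite E ltnn.
Qed.

Lemma isV_ge_id i : i <= V i.
Proof. by elim: i => // i IH; apply: leq_ltn_trans IH (isV_ltn _ _ _). Qed.

Lemma isV_gt0 i : 0 < V i.
Proof.
case: i => [|i]; first by case: V_ab => ->.
by apply: leq_trans (isV_ge_id _).
Qed.

(** Terms are positive, so both summands of [n] have index below [m] and the bounded count sees
    every sum; by injectivity, an unordered pair of terms is one index pair. *)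
Lemma nreps_eq1 m n : n <= V m ->
  (nreps V m n = 1 <-> exists x y, [/\ is_term V x, is_term V y, x + y = n &
     forall x' y', is_term V x' -> is_term V y' -> x' + y' = n ->
       x' = x \/ x' = y]).
Proof.
move=> n_le.
have lt_m i j : V i + V j = n -> i < m.
  move=> ij; rewrite ltnNge; apply/negP; rewrite leq_eqVlt => /predU1P[E|/isV_ltn].
    by have := isV_gt0 j; rewrite -ij E in n_le *; lia.
  by have := isV_gt0 j; lia.
split=> [/eqP/cards1P[[i j]] /setP E|[x [y [[i Vi] [j Vj] xy uniq_xy]]]].
  have := E (i, j); rewrite !inE eqxx /= => /andP[le_ij /eqP ij].
  exists (V i), (V j); split=> //; [by exists i|by exists j|].
  move=> _ _ [i' <-] [j' <-] ij'.
  have ji' : V j' + V i' = n by rewrite addnC.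
  have := E (Ordinal (lt_m _ _ ij'), Ordinal (lt_m _ _ ji')).
  have := E (Ordinal (lt_m _ _ ji'), Ordinal (lt_m _ _ ij')).
  rewrite !inE /= ij' ji' eqxx !andbT !xpair_eqE -!val_eqE /=.
  have [le|/ltnW le] := leqP i' j'.
    by move=> _ /esym/andP[/eqP-> _]; left.
  by rewrite le => /esym/andP[_ /eqP->] _; right.
wlog le_ij : x y i j Vi Vj xy uniq_xy / i <= j => [W|].
  have [|/ltnW le_ji] := leqP i j; first exact: (W x y).
  apply: (W y x j i) => //; first by rewrite addnC.
  by move=> x' y' Tx' Ty' /(uniq_xy _ _ Tx' Ty'); tauto.
have ij : V i + V j = n by rewrite Vi Vj.
have ji : V j + V i = n by rewrite addnC.
apply/eqP/cards1P; exists (Ordinal (lt_m _ _ ij), Ordinal (lt_m _ _ ji)).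
apply/setP => -[p q]; rewrite !inE xpair_eqE -!val_eqE /=.
apply/idP/idP => [/andP[le_pq /eqP pq]|/andP[/eqP-> /eqP->]]; last first.
  by rewrite le_ij ij eqxx.
have [] := uniq_xy (V p) (V q) (ex_intro _ _ erefl) (ex_intro _ _ erefl) pq.
  rewrite -Vi => Vp; rewrite (isV_inj _ _ Vp) eqxx.
  by apply/eqP/isV_inj; lia.
rewrite -Vj => Vp; have pj := isV_inj _ _ Vp.
have qi : nat_of_ord q = i by apply: isV_inj; lia.
by apply/andP; split; lia.
Qed.

(** For the least [m] with [n <= V m], either [n = V m] was chosen or [n] lies strictly between
    consecutive terms and was rejected. *)
Lemma isV_greedy n : b < n ->
  (is_term V n <-> exists x y, [/\ is_term V x, is_term V y, x + y = n &
     forall x' y', is_term V x' -> is_term V y' -> x' + y' = n ->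
       x' = x \/ x' = y]).
Proof.
have [V0 V1 VS] := V_ab => lt_b.
have ex_m : exists m, n <= V m by exists n; apply: isV_ge_id.
case: (ex_minnP ex_m) => m n_le m_min.
have lt_n i : i < m -> V i < n.
  by move=> lt_im; rewrite ltnNge; apply/negP => /m_min; lia.
rewrite -(nreps_eq1 _ _ n_le).
case: m => [|[|m]] in n_le m_min lt_n *; try by rewrite ?V0 ?V1 in n_le; lia.
have [_ reps1 reps_ne1] := VS m; move: n_le; rewrite leq_eqVlt => /predU1P[->|n_lt].
  by split=> // _; exists m.+2.
split=> [[i Vi]|]; last by move/reps_ne1; rewrite n_lt lt_n // => /(_ isT).
have [/lt_n|] := ltnP i m.+2; first by lia.
by rewrite leq_eqVlt => /predU1P[E|/isV_ltn]; [rewrite E in n_lt|]; lia.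
Qed.

Lemma isV_le_b n : is_term V n -> n <= b -> n = a \/ n = b.
Proof.
have [V0 V1 VS] := V_ab; case=> -[|[|i]] <-; [by left|by right|].
by have := isV_ltn 1 i.+2 isT; lia.
Qed.

(** Since [i <= V i], a term below [n] also has its index below [n]. *)
Lemma leq_size_even_terms (s : seq nat) n : uniq s ->
    (forall x, x \in s -> [/\ x < n, ~~ odd x & is_term V x]) ->
  size s <= #|[set i : 'I_n | ~~ odd (V i)]|.
Proof.
move=> uniq_s sP; rewrite cardE -(size_map (fun i : 'I_n => V i)).
apply: uniq_leq_size => // x /sP[lt_x ev_x [i Vi]].
have lt_i : i < n by apply: leq_ltn_trans (isV_ge_id i) _; rewrite Vi.
by apply/mapP; exists (Ordinal lt_i); rewrite ?mem_enum ?inE /= Vi.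
Qed.

End Terms.

Theorem theorem1p4 (a b : nat) (V : nat -> nat) (a_gt0 : 0 < a) (b_gt0 : 0 < b)
    (coprime_ab : coprime a b) (even_a : ~~ odd a) (lt_2a_b : 2 * a < b)
    (V_ab : isV a b V) :
  exists n : nat, 2 + a %/ 4 <= #|[set i : 'I_n | ~~ odd (V i)]|.
Proof.
have lt_ab : a < b by lia.
have [V0 V1 _] := V_ab.
have sh N n := shape_upto a b (is_term V) a_gt0 coprime_ab even_a lt_2a_b
  (ex_intro _ 0 V0) (ex_intro _ 1 V1) (isV_le_b _ _ _ a_gt0 lt_ab V_ab)
  (isV_greedy _ _ _ a_gt0 lt_ab V_ab) N n.
pose s := a :: 2 * b :: [seq 4 * k * b + a | k <- iota 1 (a %/ 4)].
(* This exceeds every listed term, because [4 * k <= a]. *)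
exists (a * b + 2 * b + a).+1.
have -> : 2 + a %/ 4 = size s by rewrite /= size_map size_iota.
apply: (leq_size_even_terms a b) => //.
  rewrite /= inE negb_or; apply/and3P; split.
  - apply/andP; split; first by lia.
    by apply/mapP => -[k]; rewrite mem_iota; nia.
  - by apply/mapP => -[k _]; apply: mulb_neq_addba.
  - rewrite map_inj_uniq ?iota_uniq // => k k' /addIn/eqP.
    by rewrite eqn_pmul2r // => /eqP; lia.
move=> x; rewrite !inE => /or3P[/eqP->|/eqP->|/mapP[k]].
- by split=> //; [lia|exists 0].
- split; [lia|by rewrite oddM|].
  (* As [2 <= a], the range up to [a * b] suffices, and it is allowed even for [a = 2]. *)
  apply: (shape_term _ _ _ _ (sh (a * b) _ _ _ _)); rewrite ?leq_mul2r; try lia.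
  exact: Or32.
rewrite mem_iota => /andP[k0 k_lt] ->; have k_a : 4 * k <= a by lia.
have := leq_mul k_a (leqnn b) => le_kb.
split; [lia|by rewrite oddD -mulnA oddM (negbTE even_a)|].
(* Here [k >= 1] forces [a >= 4], which allows the longer range. *)
apply: (shape_term _ _ _ _ (sh (a * b + a) _ _ _ _)); try lia.
by apply: Or33; exists k.
Qed.
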